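(* Let $A\in\mathcal{M}_0$. If $A$ is invertible in $(\mathcal{M},\circledast)$, then its inverse $B=A^{-1}$ belongs to $\mathcal{M}_0$.
   Context: Let $d\ge 1$, let $p\ge 1$ and $q$ be relatively prime integers, and put $\omega=e^{2\pi i q/p}$. Let $\ell^1(\mathbb{Z}^{2d})$ be the space of absolutely summable complex sequences $a=(a_{k,l})_{k,l\in\mathbb{Z}^d}$, with ordinary convolution $(a\ast b)_{m,n}=\sum_{k,l\in\mathbb{Z}^d}a_{k,l}\,b_{m-k,n-l}$; its unit is the delta sequence $\delta$ ($\delta_{0,0}=1$, all other entries $0$). Let $Z_p=\mathbb{Z}/p\mathbb{Z}$; arithmetic on elements of $Z_p^d$ is modulo $p$, and $x\cdot y$ is the standard inner product, so that $\omega^{x\cdot y}$ is well defined for $x,y\in Z_p^d$. For $a\in\ell^1(\mathbb{Z}^{2d})$ and $r,s\in Z_p^d$, the sequence $a^{r,s}$ is defined by $(a^{r,s})_{k,l}=a_{k,l}$ if $k\equiv r$ and $l\equiv s \pmod p$ (componentwise), and $(a^{r,s})_{k,l}=0$ otherwise. Let $N=p^d$, $\mathcal{I}=\{1,\dots,N\}$, and fix an enumeration $k_1,\dots,k_N$ of the elements of $Z_p^d$ with $k_1=(0,\dots,0)$. $\mathcal{M}$ is the algebra of $N\times N$ matrices (indexed by $\mathcal{I}\times\mathcal{I}$) with entries in $\ell^1(\mathbb{Z}^{2d})$, with multiplication $(A\circledast B)_{i,j}=\sum_{l\in\mathcal{I}}A_{i,l}\ast B_{l,j}$; its identity $\mathrm{Id}$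 is the matrix with $\delta$ on the diagonal and the zero sequence elsewhere. Finally, $\mathcal{M}_0$ is the set of all $A\in\mathcal{M}$ for which there exists $a\in\ell^1(\mathbb{Z}^{2d})$ such that $A_{i,j}=\sum_{m\in Z_p^d}\omega^{m\cdot k_j}\,a^{m,k_i-k_j}$ for all $i,j\in\mathcal{I}$. *)

(* Defs.v *)
(* The complex numbers are R[i] (mathcomp-real-closed), for R a realType of
   MathComp-Analysis. *)
From mathcomp Require Import all_boot all_order all_algebra finmap.
From mathcomp Require Import all_classical all_reals all_analysis.
From mathcomp.analysis Require showcase.summability.
From mathcomp Require Import complex.

Set Implicit Arguments.
Unset Strict Implicit.
Unset Printing Implicit Defensive.

Import Order.TTheory GRing.Theory Num.Theory.
Import numFieldNormedType.Exports.

Local Open Scope ring_scope.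
Local Open Scope complex_scope.

(* Z^{2d}, as pairs (k, l) of vectors of Z^d *)
Notation ZZ d := ('rV[int]_d * 'rV[int]_d)%type.

(* Z_p^d for p > 0: then p.-1.+1 = p, and 'I_p.-1.+1 carries addition modulo p.
   Unlike 'Z_p, this is also right for p = 1. *)
Notation Zpd p d := ('rV['I_p.-1.+1]_d).

(* Matrices of size N = p^d, with entries complex families indexed by Z^{2d} *)
Notation seqmx R p d := ('M[ZZ d -> R[i]]_(p ^ d)%N).

(* The inner product of Z_p^d, computed on the representatives in [0, p). It is
   only used as an exponent of omega, and omega ^+ p = 1. *)
Definition dot (p d : nat) (x y : Zpd p d) : nat :=
  (\sum_(j < d) x ord0 j * y ord0 j)%N.

Definition congr_mod (p d : nat) (k : 'rV[int]_d) (r : Zpd p d) : bool :=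
  [forall j, (k ord0 j == (r ord0 j : nat)%:Z %[mod p%:Z])%Z].

Section TwistedMatrices.
Context {R : realType}.

(* e^{2 pi i q / p} *)
Definition omega (p : nat) (q : int) : R[i] :=
  let t : R := 2 * pi * q%:~R / p%:R in cos t +i* sin t.

(* Unordered sum: the limit of the finite partial sums along the finite subsets
   of I ordered by inclusion; it exists when f is absolutely summable. *)
Definition csum (I : choiceType) (f : I -> R[i]) : R[i] :=
  @summability.sum I R[i] R[i]^o f.

Definition ell1 (d : nat) (a : ZZ d -> R[i]) : Prop :=
  (\esum_(u in [set: ZZ d]) (Normc.normc (a u))%:E < +oo)%E.

Definition convolution (d : nat) (a b : ZZ d -> R[i]) : ZZ d -> R[i] :=
  fun u => csum (fun v : ZZ d => a v * b (u - v)).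

Definition delta (d : nat) : ZZ d -> R[i] := fun u => (u == 0)%:R.

(* a^{r,s} *)
Definition residue_part (p d : nat) (r s : Zpd p d) (a : ZZ d -> R[i]) :
    ZZ d -> R[i] :=
  fun u => if congr_mod u.1 r && congr_mod u.2 s then a u else 0.

Definition in_M (p d : nat) (A : seqmx R p d) : Prop :=
  forall i j, ell1 (A i j).

Definition mulM (p d : nat) (A B : seqmx R p d) : seqmx R p d :=
  \matrix_(i, j) (fun u => \sum_l convolution (A i l) (B l j) u).

Definition idM (p d : nat) : seqmx R p d :=
  \matrix_(i, j) (if i == j then @delta d else fun=> 0).

Definition inverse_in_M (p d : nat) (A B : seqmx R p d) : Prop :=
  [/\ in_M B, mulM A B = idM p d & mulM B A = idM p d].

Definition in_M0 (p d : nat) (q : int) (k : 'I_(p ^ d)%N -> Zpd p d)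
    (A : seqmx R p d) : Prop :=
  in_M A /\
  exists a : ZZ d -> R[i], ell1 a /\
    forall i j u,
      A i j u = \sum_(m : Zpd p d)
        omega p q ^+ dot m (k j) * residue_part m (k i - k j) a u.

End TwistedMatrices.

(* Main.v *)
Require Import Defs.
From mathcomp Require Import all_boot all_order all_algebra finmap.
From mathcomp Require Import all_classical all_reals all_analysis.
From mathcomp.analysis Require Import showcase.summability.
From mathcomp Require Import complex.

Import Order.TTheory GRing.Theory Num.Theory.
Import numFieldNormedType.Exports.

(** Why the theorem holds.  Write [chi x y] for [omega ^+ dot x y]: it turns
    sums in either argument into products, because [omega ^+ p = 1].  A matrix
    [A] belongs to M_0 exactly when, for some summable [a],
      [A i j u = chi (u.1 mod p) (k j) * a u]  if [u.2 mod p = k i - k j],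
    and [A i j u = 0] otherwise ([in_M0P]); this matrix is [twist q k a] below.
    It is determined by its column at the index [o] with [k o = 0]: each value
    [a u] appears in that column, in the row given by the residue of [u.2].

    Let [B] be the inverse of [A = twist q k a].  Column [o] of [B] defines a
    summable family [b], written [untwist k' B], whether or not [B] is known to
    lie in M_0.  The matrix [twist q k b] is a right inverse of [A]: after
    translating the summation index by [k j], entry [(i, j)] of the product is
    the entry of [A * B = Id] in column [o] and in the row of [k i - k j],
    restricted to the [u] with [u.2 mod p = k i - k j] and multiplied by
    [chi (u.1 mod p) (k j)] ([mulM_twist_untwist]); and Id is unchanged by this
    operation ([twist_untwist1]).  The product in M is associative, so a left
    inverse equals a right inverse, and [B = twist q k b] is in M_0.

    The analytic content is thus the associativity of convolution on l^1
    ([convolutionA]), which comes from a Fubini theorem for unordered sums of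
    complex numbers ([csum_fubini]).  That theorem follows from the Tonelli
    theorem for sums of nonnegative numbers, because an absolutely summable
    complex family is a linear combination of nonnegative ones
    ([abs_summable_ind]). *)

Set Implicit Arguments.
Unset Strict Implicit.
Unset Printing Implicit Defensive.

Local Open Scope classical_set_scope.
Local Open Scope ring_scope.
Local Open Scope complex_scope.

#[local] Existing Instance totally_filter.

(** * Unordered sums of complex numbers *)

Section Csum.
Context {R : realType}.

Lemma normc_ge0 (z : R[i]) : 0 <= Normc.normc z.
Proof. by case: z => x y; exact: sqrtr_ge0. Qed.

Lemma normcD (z w : R[i]) :
  Normc.normc (z + w) <= Normc.normc z + Normc.normc w.
Proof. exact: le_normcD. Qed.

Lemma normc_real (x : R) : 0 <= x -> Normc.normc x%:C = x.
Proof. by move=> x0; rewrite /= expr0n addr0 sqrtr_sqr ger0_norm. Qed.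

Definition abs_summable (I : choiceType) (f : I -> R[i]) : Prop :=
  (\esum_(i in [set: I]) (Normc.normc (f i))%:E < +oo)%E.

Definition has_csum (I : choiceType) (f : I -> R[i]) (s : R[i]) : Prop :=
  partial_sum f @ totally --> (s : R[i]^o).

(** Real tolerances and plain finite sums keep the topology of [R[i]] out of the
    later proofs. *)
Lemma has_csumP (I : choiceType) (f : I -> R[i]) (s : R[i]) :
  has_csum f s <-> forall e : R, 0 < e -> exists X : {fset I},
    forall J : {fset I}, (X `<=` J)%fset ->
      Normc.normc (s - \sum_(i <- J) f i) <= e.
Proof.
have psumE J : partial_sum f J = \sum_(i <- J) f i.
  by rewrite /partial_sum (big_seq_fsetE _ _ xpredT).
split=> [/(@cvgrPdist_le _ R[i]^o) fs e e0|fs].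
  have [|X _ XP] := fs e%:C; first by rewrite ltcR.
  by exists X => J XJ; have := XP J XJ; rewrite -psumE /= lecR.
apply/(@cvgrPdist_le _ R[i]^o) => eps eps0.
have [e e0 ->] : exists2 e : R, 0 < e & eps = e%:C.
  exists (complex.Re eps); first by move: eps0; rewrite ltcE => /andP[].
  by rewrite RRe_real// gtr0_real.
have [X XP] := fs e e0.
by exists X => // J XJ; have := XP J XJ; rewrite -psumE -lecR.
Qed.

Lemma csum_eq (I : choiceType) (f : I -> R[i]) s : has_csum f s -> csum f = s.
Proof. by move=> fs; apply: (@cvg_lim R[i]^o) fs; exact: norm_hausdorff. Qed.

Lemma has_csumD (I : choiceType) (f g : I -> R[i]) s t :
  has_csum f s -> has_csum g t -> has_csum (fun i => f i + g i) (s + t).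
Proof.
move=> /has_csumP fs /has_csumP gt; apply/has_csumP => e e0.
have [X XP] := fs _ (divr_gt0 e0 (ltr0n _ 2)).
have [Y YP] := gt _ (divr_gt0 e0 (ltr0n _ 2)).
exists (X `|` Y)%fset => J; rewrite fsubUset => /andP[/XP XJ /YP YJ].
rewrite big_split opprD addrACA (le_trans (normcD _ _))//.
by rewrite [leRHS](splitr e) lerD.
Qed.

Lemma has_csumZ (I : choiceType) (f : I -> R[i]) c s :
  has_csum f s -> has_csum (fun i => c * f i) (c * s).
Proof.
move=> /has_csumP fs; apply/has_csumP => e e0.
have c0 := normc_ge0 c.
have c1 : 0 < Normc.normc c + 1 by rewrite ltr_wpDl.
have [X XP] := fs _ (divr_gt0 e0 c1).
exists X => J /XP XJ; rewrite -mulr_sumr -mulrBr Normc.normcM.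
apply: (le_trans (ler_wpM2l c0 XJ)); rewrite mulrCA ger_pMr//.
by rewrite ler_pdivrMr// mul1r lerDl.
Qed.

Lemma ge0_esumZl (I : choiceType) (c : R) (f : I -> \bar R) : 0 <= c ->
  (forall i, 0 <= f i)%E ->
  (\esum_(i in [set: I]) (c%:E * f i) = c%:E * \esum_(i in [set: I]) f i)%E.
Proof.
move=> c0 f0; rewrite /esum -ereal_supZl//; last first.
  by apply/set0P; eexists; exists set0; first exact: fsets_set0.
congr ereal_sup; rewrite image_comp.
by apply: eq_imagel => A _ /=; rewrite ge0_mule_fsumr.
Qed.

(** The supremum of the finite sums of a nonnegative family is also their limit,
    since these sums grow with the finite set. *)
Lemma has_csum_real (I : choiceType) (f : I -> R) :
  (forall i, 0 <= f i) -> (\esum_(i in [set: I]) (f i)%:E < +oo)%E ->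
  has_csum (fun i => (f i)%:C) (fine (\esum_(i in [set: I]) (f i)%:E))%:C.
Proof.
move=> f0 foo; set S := fine _.
have S_fin : (\esum_(i in [set: I]) (f i)%:E)%E \is a fin_num.
  by rewrite ge0_fin_numE// esum_ge0// => i _; rewrite lee_fin.
have S_E : (\esum_(i in [set: I]) (f i)%:E = S%:E)%E by rewrite fineK.
apply/has_csumP => e e0.
have [_ [X [finX _] <-]] := ub_ereal_sup_adherent e0 S_fin.
rewrite -/(esum _ _) S_E fsbig_finite//= sumEFin lte_fin => ltX.
exists (fset_set X) => J XJ.
have leJ : \sum_(i <- J) f i <= S.
  rewrite -lee_fin -S_E esum_ge//; exists [set` J] => //.
  by rewrite fsbig_finite//= set_fsetK sumEFin.
have leXJ : \sum_(i <- fset_set X) f i <= \sum_(i <- J) f i.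
  rewrite -lee_fin -!sumEFin; apply: lee_sum_nneg_subfset; first exact/fsubsetP.
  by move=> i _ _; rewrite lee_fin.
rewrite (_ : _ - _ = (S - \sum_(i <- J) f i)%:C); last first.
  by rewrite rmorphB rmorph_sum.
rewrite normc_real ?subr_ge0// lerBlDr -lerBlDl.
exact: ltW (lt_le_trans ltX leXJ).
Qed.

Lemma le_abs_summable (I : choiceType) (f g : I -> R[i]) :
  (forall i, Normc.normc (f i) <= Normc.normc (g i)) ->
  abs_summable g -> abs_summable f.
Proof.
by move=> fg; apply: le_lt_trans; apply: le_esum => i _; rewrite lee_fin.
Qed.

Lemma abs_summableD (I : choiceType) (f g : I -> R[i]) :
  abs_summable f -> abs_summable g -> abs_summable (fun i => f i + g i).
Proof.
move=> fs gs; apply: le_lt_trans (lte_add_pinfty fs gs).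
rewrite -esumD; try by move=> i _; rewrite lee_fin normc_ge0.
by apply: le_esum => i _; rewrite -EFinD lee_fin normcD.
Qed.

Lemma abs_summableZ (I : choiceType) (f : I -> R[i]) c :
  abs_summable f -> abs_summable (fun i => c * f i).
Proof.
move=> fs; rewrite /abs_summable.
under eq_esum do rewrite Normc.normcM EFinM.
rewrite ge0_esumZl ?normc_ge0//; last by move=> i; rewrite lee_fin normc_ge0.
by rewrite lte_mul_pinfty ?lee_fin ?normc_ge0.
Qed.

(** Real and imaginary parts, then positive and negative parts, write any
    absolutely summable family as a combination of nonnegative ones.  Statements
    linear in the family therefore reduce to [esum]. *)
Lemma abs_summable_ind (I : choiceType) (P : (I -> R[i]) -> Prop) :
  (forall f g, abs_summable f -> abs_summable g -> P f -> P g ->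
     P (fun i => f i + g i)) ->
  (forall c f, abs_summable f -> P f -> P (fun i => c * f i)) ->
  (forall f : I -> R, (forall i, 0 <= f i) ->
     (\esum_(i in [set: I]) (f i)%:E < +oo)%E -> P (fun i => (f i)%:C)) ->
  forall f, abs_summable f -> P f.
Proof.
move=> PD PZ Preal f fs.
have leRe (z : R[i]) : `|complex.Re z| <= Normc.normc z.
  by case: z => x y /=; rewrite -sqrtr_sqr ler_wsqrtr// lerDl sqr_ge0.
have leIm (z : R[i]) : `|complex.Im z| <= Normc.normc z.
  by case: z => x y /=; rewrite -sqrtr_sqr ler_wsqrtr// lerDr sqr_ge0.
pose S (g : I -> R[i]) := abs_summable g /\ P g.
have SD g h : S g -> S h -> S (fun i => g i + h i).
  by move=> [gs Pg] [hs Ph]; split; [exact: abs_summableD|exact: PD].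
have SZ c g : S g -> S (fun i => c * g i).
  by move=> [gs Pg]; split; [exact: abs_summableZ|exact: PZ].
have Sreal (g : I -> R) : (forall i, `|g i| <= Normc.normc (f i)) ->
    S (fun i => (Num.max (g i) 0)%:C).
  move=> gf; have g0 i : 0 <= Num.max (g i) 0 by rewrite le_max lexx orbT.
  have gs : (\esum_(i in [set: I]) (Num.max (g i) 0)%:E < +oo)%E.
    apply: le_lt_trans fs; apply: le_esum => i _; rewrite lee_fin.
    by rewrite (le_trans _ (gf i))// ge_max ler_norm normr_ge0.
  split; last exact: Preal.
  by rewrite /abs_summable; under eq_esum do rewrite normc_real//.
have parts (x : R) : x = Num.max x 0 - Num.max (- x) 0.
  have [x0|x0] := leP 0 x; first by rewrite max_r ?oppr_le0// subr0.
  by rewrite max_l ?oppr_ge0 1?ltW// opprK add0r.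
have Sparts (g : I -> R) : (forall i, `|g i| <= Normc.normc (f i)) ->
    S (fun i => (g i)%:C).
  move=> gf; rewrite [X in S X](_ : _ = fun i =>
      (Num.max (g i) 0)%:C + (-1) * (Num.max (- g i) 0)%:C); last first.
    by apply/funext => i; rewrite mulN1r -rmorphB -parts.
  by apply: SD; last apply: SZ; apply: Sreal => // i; rewrite normrN.
suff [] : S f by [].
rewrite [X in S X](_ : _ = fun i =>
    (complex.Re (f i))%:C + 'i * (complex.Im (f i))%:C); last first.
  by apply/funext => i; exact: complexE.
by apply: SD; last apply: SZ; exact: Sparts.
Qed.

Lemma abs_summable_has_csum (I : choiceType) (f : I -> R[i]) :
  abs_summable f -> has_csum f (csum f).
Proof.
elim/abs_summable_ind: f / => [f g _ _ Pf Pg|c f _ Pf|f f0 fs].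
- by have H := has_csumD Pf Pg; rewrite (csum_eq H).
- by have H := has_csumZ (c := c) Pf; rewrite (csum_eq H).
- by have H := has_csum_real f0 fs; rewrite (csum_eq H).
Qed.

Lemma csumD (I : choiceType) (f g : I -> R[i]) :
  abs_summable f -> abs_summable g ->
  csum (fun i => f i + g i) = csum f + csum g.
Proof.
by move=> fs gs; apply: csum_eq; apply: has_csumD; exact: abs_summable_has_csum.
Qed.

Lemma csumZ (I : choiceType) (f : I -> R[i]) c : abs_summable f ->
  csum (fun i => c * f i) = c * csum f.
Proof.
by move=> fs; apply: csum_eq; apply: has_csumZ; exact: abs_summable_has_csum.
Qed.

Lemma csum_single (I : choiceType) (f : I -> R[i]) i0 :
  (forall i, i != i0 -> f i = 0) -> csum f = f i0.
Proof.
move=> f0; apply: csum_eq; apply/has_csumP => e e0.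
exists [fset i0]%fset => J; rewrite fsub1set => i0J.
rewrite (big_fsetD1 i0)//= big1_fset => [|i].
  by rewrite addr0 subrr Normc.normc0 ltW.
by rewrite !inE => /andP[/f0].
Qed.

Lemma csum0 (I : choiceType) : csum (fun _ : I => 0 : R[i]) = 0.
Proof.
apply: csum_eq; apply/has_csumP => e e0; exists fset0 => J _.
by rewrite big1// subrr Normc.normc0 ltW.
Qed.

Lemma abs_summable0 (I : choiceType) : abs_summable (fun _ : I => 0 : R[i]).
Proof. by rewrite /abs_summable esum1// => i _; rewrite Normc.normc0. Qed.

Lemma abs_summable_sum (I : choiceType) (J : finType) (f : J -> I -> R[i]) :
  (forall j, abs_summable (f j)) -> abs_summable (fun i => \sum_j f j i).
Proof.
move=> fs; elim: (index_enum J) => [|j r IH].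
  by under eq_fun do rewrite big_nil; exact: abs_summable0.
by under eq_fun do rewrite big_cons; exact: abs_summableD.
Qed.

Lemma csum_sum (I : choiceType) (J : finType) (f : J -> I -> R[i]) :
  (forall j, abs_summable (f j)) ->
  csum (fun i => \sum_j f j i) = \sum_j csum (f j).
Proof.
move=> fs.
suff [] : abs_summable (fun i => \sum_j f j i) /\
  csum (fun i => \sum_j f j i) = \sum_j csum (f j) by [].
elim: (index_enum J) => [|j r [IHs IH]].
  under eq_fun do rewrite big_nil.
  by rewrite big_nil csum0; split=> //; exact: abs_summable0.
under eq_fun do rewrite big_cons.
by rewrite big_cons -IH csumD//; split=> //; exact: abs_summableD.
Qed.

Lemma abs_summable_reindex (I J : choiceType) (e : I -> J) (f : J -> R[i]) :
  bijective e -> abs_summable f -> abs_summable (f \o e).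
Proof.
move=> e_bij; rewrite /abs_summable (@reindex_esum _ _ _ [set: I] _ e)//.
by rewrite setTT_bijective.
Qed.

Lemma csum_reindex (I J : choiceType) (e : I -> J) (f : J -> R[i]) :
  bijective e -> abs_summable f -> csum (f \o e) = csum f.
Proof.
move=> e_bij; elim/abs_summable_ind: f / =>
  [f g fs gs IHf IHg|c f fs IH|f f0 fs].
- rewrite csumD// -IHf -IHg -csumD//; exact: abs_summable_reindex.
- by rewrite csumZ// -IH -csumZ//; exact: abs_summable_reindex.
- have E : (\esum_(j in [set: J]) (f j)%:E =
            \esum_(i in [set: I]) (f (e i))%:E)%E.
    by apply: reindex_esum; rewrite setTT_bijective.
  rewrite (csum_eq (has_csum_real f0 fs)) E; apply: csum_eq.
  by apply: (has_csum_real (f := f \o e)) => //=; rewrite -E.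
Qed.

(** The first two conclusions make the equality provable by
    [abs_summable_ind]: [csum] is linear on absolutely summable families.  They
    also give that l^1 is closed under convolution. *)
Lemma csum_fubini (I J : choiceType) (f : I * J -> R[i]) : abs_summable f ->
  [/\ forall i, abs_summable (fun j => f (i, j)),
      abs_summable (fun i => csum (fun j => f (i, j))) &
      csum (fun i => csum (fun j => f (i, j))) = csum f].
Proof.
elim/abs_summable_ind: f / => [f g fs gs [f1 f2 f3] [g1 g2 g3]|
  c f fs [f1 f2 f3]|f f0 fs].
- split; first by move=> i; exact: abs_summableD.
  + by under eq_fun do rewrite csumD//; exact: abs_summableD.
  + by under eq_fun do rewrite csumD//; rewrite !csumD// f3 g3.
- split; first by move=> i; exact: abs_summableZ.
  + by under eq_fun do rewrite csumZ//; exact: abs_summableZ.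
  + by under eq_fun do rewrite csumZ//; rewrite !csumZ// f3.
pose F i := (\esum_(j in [set: J]) (f (i, j))%:E)%E.
have F0 i : (0 <= F i)%E by apply: esum_ge0 => j _; rewrite lee_fin.
have FE : (\esum_(i in [set: I]) F i = \esum_(k in [set: I * J]) (f k)%:E)%E.
  rewrite esum_esum; last by move=> i j _ _; rewrite lee_fin.
  rewrite [X in esum X](_ : _ = [set: I * J]); last by apply/seteqP; split.
  by apply: eq_esum => -[].
have Ffin i : (F i < +oo)%E.
  apply: le_lt_trans fs; rewrite -FE; apply: esum_ge.
  by exists [set i]; [split|rewrite fsbig_set1].
have FfinE i : F i = (fine (F i))%:E by rewrite fineK// ge0_fin_numE.
have cF i : csum (fun j => (f (i, j))%:C) = (fine (F i))%:C.
  apply: csum_eq.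
  by apply: (has_csum_real (f := fun j => f (i, j))) => //; exact: Ffin.
have Ffs : (\esum_(i in [set: I]) (fine (F i))%:E < +oo)%E.
  by under eq_esum do rewrite -FfinE; rewrite FE.
have fineF0 i : 0 <= fine (F i) by rewrite fine_ge0.
under eq_fun do rewrite cF.
split.
- move=> i; rewrite /abs_summable; under eq_esum do rewrite normc_real//.
  exact: Ffin.
- by rewrite /abs_summable; under eq_esum do rewrite normc_real//.
- rewrite (csum_eq (has_csum_real f0 fs)) (csum_eq (has_csum_real fineF0 Ffs)).
  by under eq_esum do rewrite -FfinE; rewrite FE.
Qed.

Lemma abs_summable_bounded (I : choiceType) (f : I -> R[i]) : abs_summable f ->
  exists2 C : R, 0 <= C & forall i, Normc.normc (f i) <= C.
Proof.
move=> fs; pose S : \bar R := (\esum_(i in [set: I]) (Normc.normc (f i))%:E)%E.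
have S0 : (0 <= S)%E by apply: esum_ge0 => i _; rewrite lee_fin normc_ge0.
exists (fine S); first exact: fine_ge0.
move=> i; rewrite -lee_fin fineK ?ge0_fin_numE// esum_ge//.
by exists [set i]; [split|rewrite fsbig_set1].
Qed.

Lemma swap_bij (I J : Type) : bijective (fun x : I * J => (x.2, x.1)).
Proof. by exists (fun x => (x.2, x.1)) => -[]. Qed.

Lemma addr_bij (V : zmodType) (w : V) : bijective (fun v => v + w).
Proof. by exists (fun v => v - w) => v; rewrite ?addrK ?subrK. Qed.

Lemma abs_summable_prod (I J : choiceType) (f : I * J -> R[i]) :
  (\esum_(i in [set: I]) \esum_(j in [set: J])
     (Normc.normc (f (i, j)))%:E < +oo)%E ->
  abs_summable f.
Proof.
rewrite esum_esum; last by move=> i j _ _; rewrite lee_fin normc_ge0.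
rewrite [X in esum X](_ : _ = [set: I * J]); last by apply/seteqP; split.
by rewrite /abs_summable; congr (_ < _)%E; apply: eq_esum => -[].
Qed.

End Csum.

(** * The convolution algebra and its matrices *)

Section Convolution.
Context {R : realType} {d : nat}.
Implicit Types a b c : ZZ d -> R[i].

(** The family indexed by pairs whose sums with fixed second component are the
    values of the convolution; by translation its sum of norms is the product of
    the two l^1 norms. *)
Lemma abs_summable_convolution a b : ell1 a -> ell1 b ->
  abs_summable (fun x : ZZ d * ZZ d => a x.1 * b (x.2 - x.1)).
Proof.
move=> al1 bl1; apply: abs_summable_prod => /=.
pose S : \bar R := (\esum_(v in [set: ZZ d]) (Normc.normc (b v))%:E)%E.
have S0 : (0 <= S)%E by apply: esum_ge0 => i _; rewrite lee_fin normc_ge0.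
have SE : S = (fine S)%:E by rewrite fineK// ge0_fin_numE.
under eq_esum => w _.
  under eq_esum do rewrite Normc.normcM EFinM.
  rewrite ge0_esumZl ?normc_ge0//; last by move=> v; rewrite lee_fin normc_ge0.
  rewrite -(@reindex_esum _ _ _ [set: ZZ d] [set: ZZ d] (fun v => v - w)
    (fun v => (Normc.normc (b v))%:E)); last first.
    by rewrite setTT_bijective; exact: addr_bij.
  rewrite -/S SE muleC; over.
rewrite ge0_esumZl ?fine_ge0//; last by move=> v; rewrite lee_fin normc_ge0.
by rewrite lte_mul_pinfty// lee_fin fine_ge0.
Qed.

Lemma convolution_fubini a b : ell1 a -> ell1 b ->
  (forall u, abs_summable (fun v => a v * b (u - v))) /\ ell1 (convolution a b).
Proof.
move=> al1 bl1.
have /csum_fubini[? ? _] :=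
  abs_summable_reindex (@swap_bij _ _) (abs_summable_convolution al1 bl1).
by split.
Qed.

(** Both sides are iterated sums of one absolutely summable family [H] on pairs,
    whose term at [(w, v)] uses [a] at [w], [b] at [v - w] and [c] at [u - v].
    As [c] is bounded, its summability reduces to [abs_summable_convolution]. *)
Lemma convolutionA a b c : ell1 a -> ell1 b -> ell1 c ->
  convolution a (convolution b c) = convolution (convolution a b) c.
Proof.
move=> al1 bl1 cl1; apply/funext => u; rewrite /convolution.
pose H (x : ZZ d * ZZ d) := c (u - x.2) * (a x.1 * b (x.2 - x.1)).
have Hs : abs_summable H.
  have [C C0 cC] := abs_summable_bounded cl1.
  apply: (@le_abs_summable _ _ _ (fun x => C%:C * (a x.1 * b (x.2 - x.1)))).
    move=> x; rewrite !(Normc.normcM _ (_ * _)) normc_real//.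
    by rewrite ler_wpM2r ?normc_ge0.
  exact/abs_summableZ/abs_summable_convolution.
have [_ _ E1] := csum_fubini Hs.
have [_ _ E2] := csum_fubini (abs_summable_reindex (@swap_bij _ _) Hs).
have ab_s := (convolution_fubini al1 bl1).1.
have bc_s := (convolution_fubini bl1 cl1).1.
transitivity (csum H).
  rewrite -E1; congr csum; apply/funext => w.
  rewrite /H /= -csumZ//.
  rewrite -[RHS](csum_reindex (addr_bij w)); last first.
    have [/(_ w) Hw _ _] := csum_fubini Hs.
    by move: Hw; rewrite /H.
  congr csum; apply/funext => v /=.
  rewrite addrK (_ : u - (v + w) = u - w - v); last first.
    by rewrite opprD addrA addrAC.
  by rewrite [RHS]mulrC mulrA.
rewrite -(csum_reindex (@swap_bij _ _) Hs) -E2; congr csum.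
apply/funext => v.
by rewrite /H /= csumZ// mulrC.
Qed.

Lemma delta_convolution a : convolution (@delta R d) a = a.
Proof.
apply/funext => u; rewrite /convolution (csum_single (i0 := 0)).
  by rewrite /delta eqxx mul1r subr0.
by move=> v /negPf v0; rewrite /delta v0 mul0r.
Qed.

Lemma convolution_delta a : convolution a (@delta R d) = a.
Proof.
apply/funext => u; rewrite /convolution (csum_single (i0 := u)).
  by rewrite /delta subrr eqxx mulr1.
by move=> v /negPf vu; rewrite /delta subr_eq0 eq_sym vu mulr0.
Qed.

Lemma convolution0l a : convolution (fun=> 0) a = fun=> 0.
Proof.
by apply/funext => u; rewrite /convolution; under eq_fun do rewrite mul0r;
  exact: csum0.
Qed.

Lemma convolution0r a : convolution a (fun=> 0) = fun=> 0.
Proof.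
by apply/funext => u; rewrite /convolution; under eq_fun do rewrite mulr0;
  exact: csum0.
Qed.

Lemma convolution_suml (J : finType) (f : J -> ZZ d -> R[i]) b u :
  (forall j, ell1 (f j)) -> ell1 b ->
  convolution (fun v => \sum_j f j v) b u = \sum_j convolution (f j) b u.
Proof.
move=> fs bl1; rewrite /convolution -csum_sum; last first.
  by move=> j; exact: (convolution_fubini (fs j) bl1).1.
by congr csum; apply/funext => v; rewrite mulr_suml.
Qed.

Lemma convolution_sumr (J : finType) (f : J -> ZZ d -> R[i]) a u :
  ell1 a -> (forall j, ell1 (f j)) ->
  convolution a (fun v => \sum_j f j v) u = \sum_j convolution a (f j) u.
Proof.
move=> al1 fs; rewrite /convolution -csum_sum; last first.
  by move=> j; exact: (convolution_fubini al1 (fs j)).1.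
by congr csum; apply/funext => v; rewrite mulr_sumr.
Qed.

End Convolution.

Section Matrices.
Context {R : realType} {p d : nat}.
Implicit Types A B C : seqmx R p d.

Lemma mulMA A B C : in_M A -> in_M B -> in_M C ->
  mulM A (mulM B C) = mulM (mulM A B) C.
Proof.
move=> Am Bm Cm; apply/matrixP => i j; rewrite !mxE; apply/funext => u.
under eq_bigr => l _.
  rewrite mxE convolution_sumr//; last first.
    by move=> m; exact: (convolution_fubini (Bm _ _) (Cm _ _)).2.
  over.
rewrite exchange_big; apply: eq_bigr => m _.
rewrite mxE convolution_suml//; last first.
  by move=> l; exact: (convolution_fubini (Am _ _) (Bm _ _)).2.
by apply: eq_bigr => l _; rewrite convolutionA.
Qed.

Lemma mul1M A : mulM (idM p d) A = A.
Proof.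
apply/matrixP => i j; rewrite mxE; apply/funext => u.
rewrite (bigD1 i)//= mxE eqxx delta_convolution big1 ?addr0// => l /negPf li.
by rewrite mxE eq_sym li convolution0l.
Qed.

Lemma mulM1 A : mulM A (idM p d) = A.
Proof.
apply/matrixP => i j; rewrite mxE; apply/funext => u.
rewrite (bigD1 j)//= mxE eqxx convolution_delta big1 ?addr0// => l /negPf lj.
by rewrite mxE lj convolution0r.
Qed.

Lemma left_right_inverse_eq A B C : in_M A -> in_M B -> in_M C ->
  mulM B A = idM p d -> mulM A C = idM p d -> B = C.
Proof.
by move=> Am Bm Cm BA1 AC1; rewrite -(mulM1 B) -AC1 mulMA// BA1 mul1M.
Qed.

End Matrices.

(** * Residues modulo p and the characters given by omega *)

Section Residues.
Context {p d : nat}.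

Definition residue (k : 'rV[int]_d) : Zpd p d :=
  \row_j inZp `|(k ord0 j %% p%:Z)%Z|%N.

Hypothesis p_gt0 : (0 < p)%N.

Lemma congr_modE (k : 'rV[int]_d) (r : Zpd p d) :
  congr_mod k r = (residue k == r).
Proof.
have p0 : p%:Z != 0 by rewrite eqz_nat -lt0n.
have resE j : (residue k ord0 j : nat)%:Z = (k ord0 j %% p%:Z)%Z.
  rewrite mxE /= modn_small ?gez0_abs ?modz_ge0//.
  by rewrite prednK// -ltz_nat gez0_abs ?modz_ge0// ltz_pmod.
have rE j : ((r ord0 j : nat)%:Z %% p%:Z)%Z = (r ord0 j : nat)%:Z.
  by rewrite modz_nat modn_small// -[ltnRHS]prednK.
apply/forallP/eqP => [kr|<- j]; last by rewrite resE modz_mod.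
apply/rowP => j; apply/val_inj/eqP.
by rewrite -eqz_nat resE (eqP (kr j)) rE.
Qed.

Lemma residueD (k l : 'rV[int]_d) : residue (k + l) = residue k + residue l.
Proof.
apply/eqP; rewrite -congr_modE; apply/forallP => j.
have H (m : 'rV_d) : (m ord0 j = (residue m ord0 j : nat)%:Z %[mod p%:Z])%Z.
  apply/eqP; have /forallP/(_ j) // : congr_mod m (residue m).
  by rewrite congr_modE.
rewrite !mxE /= [X in (X %% _)%N](_ : _ =
  (residue k ord0 j + residue l ord0 j)%N); last by rewrite !mxE.
have modpE m : (m %% p.-1.+1)%N = (m %% p)%N by rewrite prednK.
rewrite modpE -modz_nat modz_mod PoszD.
apply/eqP; rewrite -[LHS]modzDm -[RHS]modzDm.
by congr ((_ + _) %% _)%Z; exact: H.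
Qed.

Lemma residue0 : residue 0 = 0.
Proof. by apply: (addrI (residue 0)); rewrite -residueD !addr0. Qed.

Lemma residueB (k l : 'rV[int]_d) : residue (k - l) = residue k - residue l.
Proof. by apply: (addIr (residue l)); rewrite -residueD !subrK. Qed.

End Residues.

Section Characters.
Context {R : realType}.

Definition cis (t : R) : R[i] := cos t +i* sin t.

Lemma cisD s t : cis (s + t) = cis s * cis t.
Proof.
by rewrite /cis cosD sinD; simpc; congr (_ +i* _); rewrite addrC.
Qed.

Lemma cis0 : cis 0 = 1.
Proof. by rewrite /cis cos0 sin0. Qed.

Lemma cisMn t n : cis (t *+ n) = cis t ^+ n.
Proof.
by elim: n => [|n IH]; rewrite ?mulr0n ?cis0// mulrS exprS cisD IH.
Qed.

Lemma cis_2piMz (q : int) : cis (2 * pi * q%:~R) = 1.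
Proof.
have cis2pi : cis (2 * pi) = 1.
  by rewrite /cis mulrDl mul1r cosDpi sinDpi cospi sinpi opprK oppr0.
have cisn n : cis (2 * pi * n%:R) = 1 by rewrite mulr_natr cisMn cis2pi expr1n.
case: q => n; first exact: cisn.
rewrite NegzE mulrNz mulrN -[LHS]mulr1 -(cisn n.+1) -cisD.
by rewrite -pmulrn addNr cis0.
Qed.

Lemma omega_expp (p : nat) (q : int) : (0 < p)%N -> omega p q ^+ p = 1 :> R[i].
Proof.
move=> p_gt0; rewrite -[omega p q]/(cis (2 * pi * q%:~R / p%:R)) -cisMn.
rewrite -(mulr_natr (_ / _)) divfK ?cis_2piMz//.
by rewrite pnatr_eq0 -lt0n.
Qed.

(** Sums in Z_p^d are reduced modulo p, which [omega ^+ p = 1] absorbs. *)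
Lemma omega_dotDl (p d : nat) (q : int) (x x' y : Zpd p d) : (0 < p)%N ->
  omega p q ^+ dot (x + x') y =
  omega p q ^+ dot x y * omega p q ^+ dot x' y :> R[i].
Proof.
move=> p_gt0; rewrite -exprD -[LHS](expr_mod _ (omega_expp q p_gt0)).
rewrite -[RHS](expr_mod _ (omega_expp q p_gt0)).
congr (_ ^+ _); rewrite /dot -big_split /=.
apply: (big_ind2 (fun m n => m = n %[mod p])) => // [m m' n n' e e'|j _].
  by rewrite -modnDm e e' modnDm.
have modpE m : (m %% p.-1.+1)%N = (m %% p)%N by rewrite prednK.
by rewrite !mxE /= modpE modnMml mulnDl.
Qed.

Lemma dotC (p d : nat) (x y : Zpd p d) : dot x y = dot y x.
Proof. by apply: eq_bigr => j _; rewrite mulnC. Qed.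

Lemma dot0l (p d : nat) (y : Zpd p d) : dot 0 y = 0%N.
Proof. by rewrite /dot big1// => j _; rewrite mxE. Qed.

Lemma omega_dotDr (p d : nat) (q : int) (x y y' : Zpd p d) : (0 < p)%N ->
  omega p q ^+ dot x (y + y') =
  omega p q ^+ dot x y * omega p q ^+ dot x y' :> R[i].
Proof. by move=> p_gt0; rewrite !(dotC x) omega_dotDl. Qed.

(** The parts [residue_part m s a] have disjoint supports as [m] varies, so a
    single [m] contributes at [u]. *)
Lemma residue_part_sum (p d : nat) (q : int) (y s : Zpd p d)
    (a : ZZ d -> R[i]) u : (0 < p)%N ->
  \sum_(m : Zpd p d) omega p q ^+ dot m y * residue_part m s a u =
  if residue u.2 == s then omega p q ^+ dot (residue u.1) y * a u else 0.
Proof.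
move=> p_gt0; rewrite (bigD1 (residue u.1))//= big1 => [|m /negPf mu].
  rewrite addr0 /residue_part !congr_modE// eqxx /=.
  by case: ifP; rewrite ?mulr0.
by rewrite /residue_part !congr_modE// eq_sym mu mulr0.
Qed.

End Characters.

(** * The algebra M_0 *)

Section Twist.
Context {R : realType} {d p : nat} (q : int).
Context (k : 'I_(p ^ d)%N -> Zpd p d) (k' : Zpd p d -> 'I_(p ^ d)%N).
Hypotheses (p_gt0 : (0 < p)%N) (kK : cancel k k') (k'K : cancel k' k).
Implicit Types (A B : seqmx R p d) (a : ZZ d -> R[i]).

Definition twist a : seqmx R p d := \matrix_(i, j) (fun u =>
  if residue u.2 == k i - k j then omega p q ^+ dot (residue u.1) (k j) * a u
  else 0).

(** A left inverse of [twist], read off the column of index [k' 0], where the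
    character is trivial. *)
Definition untwist B : ZZ d -> R[i] := fun u => B (k' (residue u.2)) (k' 0) u.

Lemma twistE a i j u : twist a i j u =
  \sum_(m : Zpd p d) omega p q ^+ dot m (k j) * residue_part m (k i - k j) a u.
Proof. by rewrite mxE residue_part_sum. Qed.

Lemma in_M_twist a : ell1 a -> in_M (twist a).
Proof.
move=> a_l1 i j.
rewrite (_ : twist a i j = fun u => \sum_(m : Zpd p d)
    omega p q ^+ dot m (k j) * residue_part m (k i - k j) a u); last first.
  by apply/funext => u; rewrite twistE.
apply: abs_summable_sum => m; apply: abs_summableZ.
apply: le_abs_summable a_l1 => u; rewrite /residue_part.
by case: ifP => //; rewrite Normc.normc0 normc_ge0.
Qed.

Lemma in_M0P A : in_M0 q k A <-> exists2 a, ell1 a & A = twist a.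
Proof.
split=> [[_ [a [a_l1 AE]]]|[a a_l1 ->]].
  exists a => //; apply/matrixP => i j; apply/funext => u.
  by rewrite AE twistE.
split; first exact: in_M_twist.
by exists a; split=> // i j u; rewrite twistE.
Qed.

Lemma ell1_untwist B : in_M B -> ell1 (untwist B).
Proof.
move=> B_M.
(* Each [u] meets a single row, so the family is a finite sum of restrictions of
   entries of [B]. *)
have -> : untwist B = fun u =>
    \sum_i (if k i == residue u.2 then B i (k' 0) u else 0).
  apply/funext => u; rewrite (bigD1 (k' (residue u.2)))//= k'K eqxx.
  rewrite big1 ?addr0// => i ik.
  by case: eqP => // ki; rewrite -ki kK eqxx in ik.
apply: abs_summable_sum => i; apply: le_abs_summable (B_M i (k' 0)) => u.
by case: ifP => //; rewrite Normc.normc0 normc_ge0.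
Qed.

(** When [v.2] has the residue [k i - k l], the residue of [(u - v).2] is
    [k l - k j] exactly when that of [u.2] is [k i - k j]; the characters
    multiply accordingly.  So the factor that [twist] puts in entry [(i, j)]
    comes out of the product. *)
Lemma mulM_twist_untwist a B : ell1 a -> in_M B ->
  mulM (twist a) (twist (untwist B)) = twist (untwist (mulM (twist a) B)).
Proof.
move=> a_l1 B_M; have A_M := in_M_twist a_l1.
apply/matrixP => i j; apply/funext => u.
pose w : R[i] := if residue u.2 == k i - k j
  then omega p q ^+ dot (residue u.1) (k j) else 0.
transitivity (w * mulM (twist a) B (k' (k i - k j)) (k' 0) u); last first.
  rewrite [in RHS]mxE /w /untwist.
  by case: (eqVneq (residue u.2) (k i - k j)) => [->|_]; rewrite ?mul0r.
rewrite !mxE mulr_sumr.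
have shift_bij : bijective (fun l => k' (k l + k j)).
  by exists (fun l => k' (k l - k j)) => l; rewrite k'K ?addrK ?subrK kK.
(* The translate [k l + k j] turns the middle index of entry [(i, j)] into that
   of the entry in column [k' 0]. *)
rewrite (reindex _ (onW_bij _ shift_bij)) /=; apply: eq_bigr => l _.
rewrite /convolution -csumZ; last first.
  exact: (convolution_fubini (A_M _ _) (B_M _ _)).1.
congr csum; apply/funext => v; rewrite !mxE !k'K.
rewrite [k l + k j]addrC opprD addrA.
case: (eqVneq (residue v.2) (k i - k j - k l)) => [vE|_]; last first.
  by rewrite !mul0r mulr0.
have -> : k j + k l - k j = k l by rewrite addrAC subrr add0r.
rewrite /= residueB// vE subr_eq [k l + _]addrC subrK.
rewrite /w; case: (eqVneq (residue u.2) (k i - k j)) => [uE|_]; last first.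
  by rewrite mulr0 mul0r.
have -> : untwist B (u - v) = B l (k' 0) (u - v).
  by rewrite /untwist /= residueB// uE vE subKr kK.
rewrite -(subrK (residue v.1) (residue u.1)) -residueB//.
rewrite omega_dotDl// omega_dotDr// -!mulrA.
by rewrite !(mulrCA (omega p q ^+ dot (residue (u.1 - v.1)) (k j))).
Qed.

Lemma twist_untwist1 : twist (untwist (idM p d)) = idM p d.
Proof.
have idE i j u : idM p d i j u = ((i == j) && (u == 0))%:R :> R[i].
  by rewrite mxE; case: eqP.
apply/matrixP => i j; apply/funext => u; rewrite mxE /untwist !idE.
case: (u =P 0) => [->|_]; last by rewrite !andbF mulr0 if_same.
rewrite /= !residue0// dot0l mul1r eqxx eq_sym subr_eq0 (can_eq kK).
by case: (i =P j).
Qed.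

End Twist.

(* k enumerates Z_p^d; the first index is the one of value 0. *)
Theorem theorem3p4 (R : realType) (d p : nat) (q : int)
  (d_ge1 : (1 <= d)%N) (p_ge1 : (1 <= p)%N) (pq_coprime : coprimez p%:Z q)
  (k : 'I_(p ^ d)%N -> Zpd p d) (k_bij : bijective k)
  (k_first : forall i, nat_of_ord i = 0%N -> k i = 0%R)
  (A B : seqmx R p d) :
  in_M0 q k A -> inverse_in_M A B -> in_M0 q k B.
Proof.
case: k_bij => k' kK k'K.
move=> /in_M0P-/(_ p_ge1)[a a_l1 ->] [B_M mulAB mulBA].
have b_l1 := ell1_untwist kK k'K B_M.
apply/in_M0P => //; exists (untwist k' B) => //.
apply: (left_right_inverse_eq (in_M_twist q k p_ge1 a_l1)) mulBA _ => //.
  exact: in_M_twist.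
by rewrite (mulM_twist_untwist q p_ge1 kK k'K)// mulAB twist_untwist1.
Qed.
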